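(* Let $q\ge1$ and $r\ge2$ be integers, $n\ge qr$, and let $h_l$ ($l\in\mathcal L$) be real-valued functions of $r$ arguments evaluated at data points $X_1,\dots,X_n$. For $l\in\mathcal L$, $c\ge1$ and $cr\le m\le n$ let $$D^M_{c,l}(m)=\sum_{1\le i_1<\cdots<i_{cr}\le m}\ \prod_{k=1}^{c}h_l(X_{i_{(k-1)r+1}},\dots,X_{i_{kr}}),$$ with $D^M_{c,l}(m)=0$ for $m<cr$, and $D^M_{0,l}\equiv1$. Then for $c=1,\dots,q$ and $cr\le m\le n$, $$D^M_{c,l}(m)=D^M_{c,l}(m-1)+\sum_{(c-1)r<i_1<\cdots<i_{r-1}<m}D^M_{c-1,l}(i_1-1)\,h_l(X_{i_1},\dots,X_{i_{r-1}},X_m).$$ Consequently (with $r$ fixed), $D^M_{q,l}(n)$ can be computed in $O(qn^r)$ operations for each $l$, and the statistic $$U^M_{n,q}=\sum_{l\in\mathcal L}\binom{n}{qr}^{-1}\sum_{1\le i_1<\cdots<i_{qr}\le n}\ \prod_{c=1}^q h_l(X_{i_{(c-1)r+1}},\dots,X_{i_{cr}})$$ can be computed in $O(qn^r|\mathcal L|)$ operations.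
   Context: $\mathcal L$ is a finite index set. An operation means an arithmetic operation on real numbers or an evaluation of some $h_l$ at data points, each counted at unit cost. *)

(* Defs.v *)
From mathcomp Require Import all_boot all_order all_algebra.
From mathcomp Require Import reals.

Set Implicit Arguments.
Unset Strict Implicit.
Unset Printing Implicit Defensive.

Import Order.TTheory GRing.Theory Num.Theory.

Local Open Scope ring_scope.

(* Indices are 0-based: the data points X_1, ..., X_n are                     *)
(* tnth X 0, ..., tnth X (n - 1), so "i_k <= m" reads "i_k < m" below.        *)

Definition increasing (n : nat) (s : seq 'I_n) : bool :=
  sorted (fun a b : 'I_n => (a < b)%N) s.

Lemma block_index_lt (c r : nat) (k : 'I_c) (j : 'I_r) :
  (k * r + j < c * r)%N.
Proof.
apply: (@leq_trans (k.+1 * r)); last by rewrite leq_mul2r ltn_ord orbT.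
by rewrite mulSn addnC ltn_add2r.
Qed.

Definition block_index (c r : nat) (k : 'I_c) (j : 'I_r) : 'I_(c * r) :=
  Ordinal (block_index_lt k j).

(* (X_{i_{(k-1)r+1}}, ..., X_{i_{kr}}), with the 1-based k of this formula    *)
(* equal to k.+1.                                                             *)
Definition block (T : Type) (r n c : nat) (X : n.-tuple T)
    (i : (c * r).-tuple 'I_n) (k : 'I_c) : r.-tuple T :=
  [tuple tnth X (tnth i (block_index k j)) | j < r].

(* The conventions for c = 0 and for m < c r need no separate clause, see DM0 *)
(* and DM_small.                                                              *)
Definition DM (R : realType) (T : Type) (r n : nat) (X : n.-tuple T)
    (hl : r.-tuple T -> R) (c m : nat) : R :=
  \sum_(i : (c * r).-tuple 'I_n |
          increasing i && all (fun a : 'I_n => (a < m)%N) i)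
    \prod_(k < c) hl (block X i k).

Lemma DM0 (R : realType) (T : Type) (r n : nat) (X : n.-tuple T)
    (hl : r.-tuple T -> R) (m : nat) : DM X hl 0 m = 1.
Proof.
rewrite /DM (big_pred1 ([tuple] : 0.-tuple 'I_n)); first by rewrite big_ord0.
by move=> i; rewrite (tuple0 i) /= eqxx.
Qed.

Lemma DM_small (R : realType) (T : Type) (r n : nat) (X : n.-tuple T)
    (hl : r.-tuple T -> R) (c m : nat) : (m < c * r)%N -> DM X hl c m = 0.
Proof.
move=> ltm; rewrite /DM big_pred0 // => i; apply/negP => /andP[inc alt].
have us : uniq (map val i).
  by apply: (sorted_uniq ltn_trans ltnn); rewrite sorted_map.
have sub : {subset map val i <= iota 0 m}.
  by move=> _ /mapP[a ai ->]; rewrite mem_iota; exact: (allP alt).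
have := uniq_leq_size us sub.
by rewrite size_map size_tuple size_iota leqNgt ltm.
Qed.

Definition UM (R : realType) (T : Type) (L : finType) (r n : nat)
    (X : n.-tuple T) (h : L -> r.-tuple T -> R) (q : nat) : R :=
  \sum_(l : L) ('C(n, q * r)%:R)^-1 *
    \sum_(i : (q * r).-tuple 'I_n | increasing i)
      \prod_(c < q) h l (block X i c).

(* Operation counts refer to straight-line programs: a finite list of         *)
(* instructions, fixed independently of the functions h_l and of the data,    *)
(* each of which performs one arithmetic operation or one evaluation of some  *)
(* h_l at data points and stores its value in the next register.  Only the    *)
(* constants 0 and 1 are available for free.                                  *)

Inductive operand : Type := Zero | One | Reg of nat.

Inductive arith : Type := Add | Sub | Mul | Div.

Inductive instr (L : Type) (r n : nat) : Type :=
  | Arith of arith & operand & operand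
  | Eval of L & r.-tuple 'I_n.

Record program (L : Type) (r n : nat) : Type := Program {
  code : seq (instr L r n);
  output : operand
}.

Definition operations (L : Type) (r n : nat) (p : program L r n) : nat :=
  size (code p).

Definition fetch (R : realType) (mem : seq R) (a : operand) : option R :=
  match a with
  | Zero => Some 0
  | One => Some 1
  | Reg k => onth mem k
  end.

(* Unlike in the library, where x / 0 = 0, division by 0 is undefined, so     *)
(* that a program cannot test for 0 by dividing.                              *)
Definition arith_eval (R : realType) (op : arith) (x y : R) : option R :=
  match op with
  | Add => Some (x + y)
  | Sub => Some (x - y)
  | Mul => Some (x * y)
  | Div => if y == 0 then None else Some (x / y)
  end.

Definition exec (R : realType) (T L : Type) (r n : nat) (X : n.-tuple T)
    (h : L -> r.-tuple T -> R) (mem : seq R) (ins : instr L r n) : option R :=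
  match ins with
  | Arith op a b =>
      obind (fun x => obind (fun y => arith_eval op x y) (fetch mem b))
            (fetch mem a)
  | Eval l i => Some (h l [tuple tnth X (tnth i j) | j < r])
  end.

Fixpoint run (R : realType) (T L : Type) (r n : nat) (X : n.-tuple T)
    (h : L -> r.-tuple T -> R) (mem : seq R) (s : seq (instr L r n)) :
    option (seq R) :=
  if s is ins :: s' then
    obind (fun v => run X h (rcons mem v) s') (exec X h mem ins)
  else Some mem.

(* None if some step is undefined.                                            *)
Definition result (R : realType) (T L : Type) (r n : nat) (X : n.-tuple T)
    (h : L -> r.-tuple T -> R) (p : program L r n) : option R :=
  obind (fun mem => fetch mem (output p)) (run X h [::] (code p)).

(* Main.v *)
Require Import Defs.
From mathcomp Require Import all_boot all_order all_algebra.
From mathcomp Require Import reals.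
From mathcomp Require Import zify.

Set Implicit Arguments.
Unset Strict Implicit.
Unset Printing Implicit Defensive.

Import Order.TTheory GRing.Theory Num.Theory.

Local Open Scope ring_scope.

(** An increasing (c+1)r-tuple below m+1 is either below m or ends in m.  In
    the second case its last block is (i_1, ..., i_{r-1}, m) and the remaining
    cr entries form an arbitrary increasing tuple below i_1; summing over them
    gives the recursion (with 0-based indices).  The terms with i_1 < cr vanish,
    so the sum may as well run over all i_1.  Filling the table D_c(m), c <= q, m <= n, then
    costs at most 3 n^{r-1} + 1 operations per entry.  The binomial coefficient
    is obtained in O(n) operations from C(n, i+1) = C(n, i) (n - i) / (i + 1). *)

(** * Increasing sequences of indices and their concatenation *)

Lemma increasing_pairwise (n : nat) (s : seq 'I_n) :
  increasing s = pairwise (fun a b : 'I_n => (a < b)%N) s.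
Proof. by rewrite /increasing sorted_pairwise // => y x z; apply: ltn_trans. Qed.

Lemma increasing_rcons (n : nat) (s : seq 'I_n) (z : 'I_n) :
  increasing (rcons s z) = all (fun a : 'I_n => (a < z)%N) s && increasing s.
Proof. by rewrite !increasing_pairwise pairwise_rcons. Qed.

(** In an increasing [rcons i m] the first entry is the least, so comparing [a] with that entry
    alone suffices. For empty [i] this entry is [m], the default of [head]. *)
Lemma increasing_cat_rcons (n : nat) (a i : seq 'I_n) (m : 'I_n) :
  increasing (a ++ rcons i m) =
  increasing (rcons i m) &&
    (increasing a && all (fun b : 'I_n => (b < head m i)%N) a).
Proof.
rewrite (increasing_pairwise (a ++ _)) pairwise_cat -!increasing_pairwise.
case: (boolP (increasing (rcons i m))) => [inc|_]; last by rewrite !andbF.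
rewrite andbT andbC; congr (_ && _); move: inc; rewrite increasing_pairwise.
case: i => [|x i] /=; first by rewrite allrel_consr allrel0r andbT.
case/andP=> ltx _; rewrite allrel_consr; apply: andb_idr => ax.
by apply/allrelP => b y /(allP ax) /= bx /(allP ltx) /=; apply: ltn_trans bx.
Qed.

(** * The recursion, for blocks of length [r.+1] *)

Section Recurrence.

Variables (R : realType) (T : Type) (r n : nat).
Variables (X : n.-tuple T) (hl : r.+1.-tuple T -> R).

Lemma size_append (c : nat) (m : 'I_n) (a : (c * r.+1).-tuple 'I_n)
  (i : r.-tuple 'I_n) : size (a ++ rcons i m) == (c.+1 * r.+1)%N.
Proof. by rewrite size_cat size_rcons !size_tuple mulSn addnC. Qed.

Definition append c m a i := Tuple (@size_append c m a i).

Lemma block_append_widen (c : nat) (m : 'I_n) (a : (c * r.+1).-tuple 'I_n)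
    (i : r.-tuple 'I_n) (k : 'I_c) :
  block X (append m a i) (widen_ord (leqnSn c) k) = block X a k.
Proof.
apply: eq_from_tnth => j; rewrite !tnth_mktuple; congr tnth.
by rewrite !(tnth_nth m) /= nth_cat size_tuple block_index_lt.
Qed.

Lemma block_append_max (c : nat) (m : 'I_n) (a : (c * r.+1).-tuple 'I_n)
    (i : r.-tuple 'I_n) :
  block X (append m a i) ord_max = [tuple tnth X (nth m (rcons i m) j) | j < r.+1].
Proof.
apply: eq_from_tnth => j; rewrite !tnth_mktuple; congr tnth.
by rewrite (tnth_nth m) /= nth_cat size_tuple ltnNge leq_addr addKn.
Qed.

Lemma DM_rec (c : nat) (m : 'I_n) :
  DM X hl c.+1 m.+1 =
  DM X hl c.+1 m +
  \sum_(i : r.-tuple 'I_n | increasing (rcons i m))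
    DM X hl c (head m i) * hl [tuple tnth X (nth m (rcons i m) j) | j < r.+1].
Proof.
have cut_size (t : (c.+1 * r.+1).-tuple 'I_n) :
    (size (take (c * r.+1) t) == c * r.+1)%N &&
    (size (take r (drop (c * r.+1) t)) == r)%N.
  rewrite !size_take_min size_drop size_tuple mulSn addnK.
  by apply/andP; split; apply/eqP/minn_idPl; rewrite ?leq_addl.
(* Candidate inverse of [append m]: it forgets the final entry of [t], which is meant to be [m]. *)
pose cut (t : (c.+1 * r.+1).-tuple 'I_n) : r.-tuple 'I_n * (c * r.+1).-tuple 'I_n :=
  (Tuple (proj2 (andP (cut_size t))), Tuple (proj1 (andP (cut_size t)))).
rewrite {1}/DM (bigID (fun t : _.-tuple 'I_n => all (fun a : 'I_n => (a < m)%N) t)) /=.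
congr (_ + _).
  apply: eq_bigl => t; rewrite -andbA; congr (_ && _).
  by apply: andb_idl => /allP am; apply/allP => a /am/ltnW; rewrite ltnS.
rewrite (reindex_onto (fun p => append m p.2 p.1) cut) /=; last first.
  (* If [append m] does not rebuild [t] from its cut, then the last entry [z] of [t] is not [m].
     Hence [z < m], and all entries lie below [m], which this half of the sum excludes. *)
  move=> t /andP[/andP[inc am]]; apply: contraNeq => neq.
  have size_d : size (drop (c * r.+1) t) = r.+1.
    by rewrite size_drop size_tuple mulSn addnK.
  case/lastP def_d : (drop (c * r.+1) t) => [|d z]; first by rewrite def_d in size_d.
  have def_t : tval t = rcons (take (c * r.+1) t ++ d) z.
    by rewrite rcons_cat -def_d cat_take_drop.
  have zm : z != m.
    apply: contraNneq neq => zm; apply/eqP/val_inj => /=.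
    rewrite [RHS]def_t def_d -(cats1 d) take_size_cat ?zm ?rcons_cat //.
    by move: size_d; rewrite def_d size_rcons => -[].
  move: inc am; rewrite def_t increasing_rcons !all_rcons.
  case/andP=> sz _ /andP[]; rewrite ltnS leq_eqVlt (inj_eq val_inj) (negPf zm) /=.
  by move=> ltz _; rewrite ltz; apply/allP => a /(allP sz) /ltn_trans; apply.
under [RHS]eq_bigr do rewrite /DM mulr_suml.
rewrite pair_big_dep /=; apply: eq_big => [[i a]|[i a] _] /=; last first.
  rewrite big_ord_recr /= block_append_max; congr (_ * _).
  by apply: eq_bigr => k _; rewrite block_append_widen.
have -> : cut (append m a i) == (i, a).
  rewrite xpair_eqE; apply/andP; split; apply/eqP/val_inj => /=.
    by rewrite drop_size_cat ?size_tuple // -cats1 take_size_cat ?size_tuple.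
  by rewrite take_size_cat ?size_tuple.
(* The bounds on the entries follow from monotonicity: [m] is the last entry, so all are below
   [m.+1] but not all below [m]. *)
rewrite andbT -increasing_cat_rcons -andbA; apply: andb_idr.
rewrite -rcons_cat increasing_rcons => /andP[am _].
rewrite !all_rcons ltnSn ltnn /= andbT.
by apply/allP => b /(allP am)/ltnW; rewrite ltnS.
Qed.

End Recurrence.

(** * Building straight-line programs with bounds on their length *)

Section Programs.

Variables (L : Type) (r n : nat).

(** The data are quantified inside, so that a single program can be fixed before they are known. *)
Definition value : Type :=
  forall (R : realType) (T : Type) (X : n.-tuple T) (h : L -> r.-tuple T -> R), R.

Implicit Types (p s : seq (instr L r n)) (f g : value).

Definition valid p := forall (R : realType) (T : Type) (X : n.-tuple T)
  (h : L -> r.-tuple T -> R), exists mem, run X h [::] p = Some mem.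

(** The operand is chosen before the data. Only successful runs are constrained; [valid] supplies
    their existence. *)
Definition stores p f := exists a : operand, forall (R : realType) (T : Type)
    (X : n.-tuple T) (h : L -> r.-tuple T -> R) (mem : seq R),
  run X h [::] p = Some mem -> fetch mem a = Some (f R T X h).

Definition extends p k p' := valid p' /\ exists2 s, p' = p ++ s & (size s <= k)%N.

Definition reach p k (P : seq (instr L r n) -> Prop) :=
  exists2 p', extends p k p' & P p'.

Lemma run_cat (R : realType) (T : Type) (X : n.-tuple T) (h : L -> r.-tuple T -> R)
    (mem : seq R) p s :
  run X h mem (p ++ s) = obind (fun mem' => run X h mem' s) (run X h mem p).
Proof. by elim: p mem => //= ins p IH mem; case: exec => //= v; apply: IH. Qed.

Lemma run_prefix (R : realType) (T : Type) (X : n.-tuple T) (h : L -> r.-tuple T -> R)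
    (mem mem' : seq R) s :
  run X h mem s = Some mem' -> exists t, mem' = mem ++ t.
Proof.
elim: s mem => [|ins s IH] mem /=; first by move=> [<-]; exists [::]; rewrite cats0.
by case: exec => //= v /IH[t ->]; exists (v :: t); rewrite cat_rcons.
Qed.

Lemma fetch_cat (R : realType) (mem t : seq R) (a : operand) (x : R) :
  fetch mem a = Some x -> fetch (mem ++ t) a = Some x.
Proof. by case: a => //= k; elim: mem k => [|y mem IH] [|k] //= /IH. Qed.

Lemma fetch_rcons (R : realType) (mem : seq R) (x : R) :
  fetch (rcons mem x) (Reg (size mem)) = Some x.
Proof. by elim: mem. Qed.

Lemma size_run (R : realType) (T : Type) (X : n.-tuple T) (h : L -> r.-tuple T -> R)
    (mem mem' : seq R) s :
  run X h mem s = Some mem' -> size mem' = (size mem + size s)%N.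
Proof.
elim: s mem => [|ins s IH] mem /=; first by move=> [<-]; rewrite addn0.
by case: exec => //= v /IH ->; rewrite size_rcons addSnnS.
Qed.

(** Registers are written once: running more code only appends to the memory, so earlier operands
    keep their values. *)
Lemma stores_extends p k p' f : extends p k p' -> stores p f -> stores p' f.
Proof.
move=> [_ [s -> _]] [a pa]; exists a => R T X h mem; rewrite run_cat.
case E: (run X h [::] p) => [mem0|] //= /run_prefix[t ->].
exact/fetch_cat/pa.
Qed.

Lemma extends_refl p : valid p -> extends p 0 p.
Proof. by move=> vp; split=> //; exists [::]; rewrite ?cats0. Qed.

Lemma extends_trans p k p' k' p'' :
  extends p k p' -> extends p' k' p'' -> extends p (k + k') p''.
Proof.
move=> [_ [s def_p' ks]] [vp'' [s' def_p'' ks']]; split=> //.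
by exists (s ++ s'); rewrite ?catA -?def_p' // size_cat leq_add.
Qed.

Lemma reach0 p (P : seq (instr L r n) -> Prop) : valid p -> P p -> reach p 0 P.
Proof. by move=> vp Pp; exists p => //; apply: extends_refl. Qed.

Lemma reach_bind p k k' (P Q : seq (instr L r n) -> Prop) :
  reach p k P -> (forall p', extends p k p' -> P p' -> reach p' k' Q) ->
  reach p (k + k') Q.
Proof.
move=> [p' pp' Pp'] /(_ _ pp' Pp')[p'' p'p'' Qp''].
by exists p''; first exact: extends_trans pp' p'p''.
Qed.

Lemma reach_le p k k' (P : seq (instr L r n) -> Prop) :
  (k <= k')%N -> reach p k P -> reach p k' P.
Proof.
move=> kk' [p' [vp' [s def_p' ks]] Pp']; exists p' => //; split=> //.
by exists s; last exact: leq_trans kk'.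
Qed.

(** Loop rule: [P i] is the invariant after [i] rounds, each adding at most [k] instructions. *)
Lemma reach_iter p N k (P : nat -> seq (instr L r n) -> Prop) :
  valid p -> P 0%N p ->
  (forall i p', (i < N)%N -> valid p' -> P i p' -> reach p' k (P i.+1)) ->
  reach p (N * k) (P N).
Proof.
move=> vp P0 PS; suff: forall M, (M <= N)%N -> reach p (M * k) (P M) by apply.
elim=> [_|M IH ltMN]; first exact: reach0.
rewrite mulSnr; apply: reach_bind (IH (ltnW ltMN)) _ => p' [vp' _].
exact: PS.
Qed.

Lemma stores_eq p f g : stores p f ->
  (forall (R : realType) (T : Type) (X : n.-tuple T) (h : L -> r.-tuple T -> R),
    f R T X h = g R T X h) ->
  stores p g.
Proof. by move=> [a pa] fg; exists a => R T X h mem /pa ->; rewrite fg. Qed.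

Lemma stores0 p : stores p (fun _ _ _ _ => 0).
Proof. by exists Zero. Qed.

Lemma stores1 p : stores p (fun _ _ _ _ => 1).
Proof. by exists One. Qed.

Lemma reach_instr p ins f : valid p ->
  (forall (R : realType) (T : Type) (X : n.-tuple T) (h : L -> r.-tuple T -> R) mem,
    run X h [::] p = Some mem -> exec X h mem ins = Some (f R T X h)) ->
  reach p 1 (fun p' => stores p' f).
Proof.
move=> vp fP; exists (rcons p ins).
  split; last by exists [:: ins]; rewrite ?cats1.
  move=> R T X h; have [mem E] := vp R T X h.
  by exists (rcons mem (f R T X h)); rewrite -cats1 run_cat E /= (fP _ _ _ _ _ E).
(* The memory starts empty and grows by one per instruction, so the new value lands in register
   [size p]. *)
exists (Reg (size p)) => R T X h mem'.
have [mem E] := vp R T X h; rewrite -cats1 run_cat E /= (fP _ _ _ _ _ E) /= => -[<-].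
by have := size_run E; rewrite add0n => <-; apply: fetch_rcons.
Qed.

Lemma reach_arith (op : arith) p f g (u : value) : valid p -> stores p f -> stores p g ->
  (forall (R : realType) (T : Type) (X : n.-tuple T) (h : L -> r.-tuple T -> R),
    arith_eval op (f R T X h) (g R T X h) = Some (u R T X h)) ->
  reach p 1 (fun p' => stores p' u).
Proof.
move=> vp [a pa] [b pb] uP; apply: (@reach_instr _ (Arith L r n op a b)) => //.
by move=> R T X h mem E /=; rewrite (pa _ _ _ _ _ E) (pb _ _ _ _ _ E) /=.
Qed.

Lemma reach_eval p (l : L) (i : r.-tuple 'I_n) : valid p ->
  reach p 1 (fun p' => stores p' (fun R T X h => h l [tuple tnth X (tnth i j) | j < r])).
Proof. by move=> vp; apply: (@reach_instr _ (Eval l i)). Qed.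

(** Each term costs [k] instructions plus one addition to the partial sum. Terms are computed after
    the code of other terms, hence the hypothesis on all extensions of [p]. *)
Lemma reach_sum (J : Type) (s : seq J) (F : J -> value) p k : valid p ->
  (forall j p' k', extends p k' p' -> reach p' k (fun p'' => stores p'' (F j))) ->
  reach p (size s * k.+1)
    (fun p' => stores p' (fun R T X h => \sum_(j <- s) F j R T X h)).
Proof.
move=> vp FP; elim: s => [|j s IH].
  apply: reach0 => //; apply: stores_eq (stores0 p) _ => R T X h.
  by rewrite big_nil.
rewrite /= mulSnr; apply: reach_bind IH _ => p' pp' p's.
rewrite -addn1; apply: reach_bind (FP j p' _ pp') _ => p'' p'p'' p''j.
have p''s := stores_extends p'p'' p's.
apply: (@reach_arith Add) (p''j) (p''s) _; first by case: p'p''.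
by move=> R T X h; rewrite big_cons.
Qed.

End Programs.

(** * Programs for the table of [DM] and for the binomial coefficient *)

Section Algorithm.

Variables (L : finType) (l : L) (r n : nat).

(** Each of the at most [n ^ r] terms takes an evaluation, a product and an addition; one further
    addition brings in the entry at [m]. *)
Lemma reach_DM_step (c m : nat) (p : seq (instr L r.+1 n)) :
  (m < n)%N -> valid p ->
  (forall j, (j <= n)%N -> stores p (fun R T X h => DM X (h l) c j)) ->
  stores p (fun R T X h => DM X (h l) c.+1 m) ->
  reach p (n ^ r * 3 + 1) (fun p' => stores p' (fun R T X h => DM X (h l) c.+1 m.+1)).
Proof.
move=> ltmn vp Dc Dm; pose m' := Ordinal ltmn.
(* The list of terms depends on [m] only, not on the data, so the sum unrolls into fixed code. *)
pose s := [seq i : r.-tuple 'I_n <- index_enum _ | increasing (rcons i m')].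
have le_s : (size s <= n ^ r)%N.
  rewrite size_filter -sum1_count sum1dep_card; apply: leq_trans (max_card _) _.
  by rewrite card_tuple card_ord.
pose F (i : r.-tuple 'I_n) : value L r.+1 n := fun R T X h =>
  DM X (h l) c (head m' i) *
    h l [tuple tnth X (tnth [tuple nth m' (rcons i m') j | j < r.+1] j) | j < r.+1].
have sumF : reach p (size s * 3)
    (fun p' => stores p' (fun R T X h => \sum_(i <- s) F i R T X h)).
  apply: reach_sum => // i p' k' pp'.
  have [vp' _] := pp'; rewrite -[2%N]/(1 + 1)%N.
  apply: reach_bind (reach_eval l [tuple nth m' (rcons i m') j | j < r.+1] vp') _.
  move=> p'' p'p'' heval; have [vp'' _] := p'p''.
  have Di := stores_extends p'p'' (stores_extends pp' (Dc _ (ltnW (ltn_ord (head m' i))))).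
  exact: (reach_arith (op := Mul) (u := F i) vp'' Di heval).
apply: reach_bind (reach_le _ sumF) _; first by rewrite leq_mul2r le_s orbT.
move=> p' pp' sumF'; have [vp' _] := pp'.
apply: (reach_arith (op := Add)) vp' (stores_extends pp' Dm) sumF' _.
move=> R T X h /=; congr Some; rewrite (DM_rec X (h l) c m') big_filter; congr (_ + _).
apply: eq_bigr => i _; rewrite /F; congr (_ * h l _).
by apply: eq_from_tnth => j; rewrite !tnth_mktuple.
Qed.

Lemma reach_DM (p : seq (instr L r.+1 n)) (q : nat) : valid p ->
  reach p (q * (n * (n ^ r * 3 + 1))) (fun p' => stores p' (fun R T X h => DM X (h l) q n)).
Proof.
(* Outer invariant: row [c] is complete. The inner [Inv'] adds the entries of row [c.+1] up to [m].
   Row 0 and the entries at 0 of later rows are the free constants 1 and 0. *)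
move=> vp; pose Inv c p := forall j, (j <= n)%N ->
  stores p (fun (R : realType) T (X : n.-tuple T) (h : L -> r.+1.-tuple T -> R) => DM X (h l) c j).
suff [p' pp' Ip'] : reach p (q * (n * (n ^ r * 3 + 1))) (Inv q).
  by exists p' => //; apply: Ip'.
apply: reach_iter => // [j _|c p1 _ vp1 I1].
  by apply: stores_eq (stores1 p) _ => R T X h; rewrite DM0.
pose Inv' m p := Inv c p /\ forall j, (j <= m)%N ->
  stores p (fun (R : realType) T (X : n.-tuple T) (h : L -> r.+1.-tuple T -> R) => DM X (h l) c.+1 j).
suff [p' pp' [_ Ip']] : reach p1 (n * (n ^ r * 3 + 1)) (Inv' n) by exists p'.
apply: reach_iter => // [|m p2 ltmn vp2 [I2 I2']].
  split=> // j; rewrite leqn0 => /eqP->.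
  apply: stores_eq (stores0 p1) _ => R T X h.
  by rewrite DM_small // mulSn addSn.
have [p' pp' Dp'] := reach_DM_step ltmn vp2 I2 (I2' _ (leqnn _)).
exists p' => //; split=> j le; first exact: stores_extends pp' (I2 _ le).
by move: le; rewrite leq_eqVlt => /predU1P[->//|/I2']; apply: stores_extends pp'.
Qed.

Lemma reach_nat (p : seq (instr L r n)) (k : nat) : valid p ->
  reach p k (fun p' => stores p' (fun _ _ _ _ => k%:R)).
Proof.
move=> vp; rewrite -{1}[k]muln1.
apply: (@reach_iter _ _ _ p k 1 (fun i p' => stores p' (fun _ _ _ _ => i%:R))) => //.
  exact: stores0.
move=> i p' _ vp' Ii; apply: (@reach_arith _ _ _ Add) Ii (stores1 p') _ => //.
by move=> R T X h; rewrite /= natr1.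
Qed.

(** The number [n] is built by [n] additions of 1. Each round then takes four operations: increment
    [i], multiply, divide by the nonzero [i.+1], and decrement [n - i]. *)
Lemma reach_bin (p : seq (instr L r n)) (k : nat) : (k <= n)%N -> valid p ->
  reach p (n + k * 4) (fun p' => stores p' (fun _ _ _ _ => 'C(n, k)%:R)).
Proof.
move=> lekn vp; apply: reach_bind (reach_nat n vp) _ => p0 [vp0 _] sn.
pose Inv i (p : seq (instr L r n)) := [/\ stores p (fun _ _ _ _ => (n - i)%:R),
  stores p (fun _ _ _ _ => i%:R) & stores p (fun _ _ _ _ => 'C(n, i)%:R)].
suff [p' pp' [_ _ Ip']] : reach p0 (k * 4) (Inv k) by exists p'.
apply: reach_iter => // [|i p1 ltik vp1 [s1 s2 s3]].
  by split; rewrite ?subn0 ?bin0 //; [apply: stores0|apply: stores1].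
have ltin := leq_trans ltik lekn.
rewrite (_ : 4 = 1 + (1 + (1 + 1)))%N //.
apply: reach_bind (reach_arith (op := Add) (u := fun _ _ _ _ => i.+1%:R) vp1 s2 (stores1 _) _) _.
  by move=> R T X h; rewrite /= -natr1.
move=> p2 e2 t2; have [vp2 _] := e2.
have {s1 s2 s3}[s1 s3] := (stores_extends e2 s1, stores_extends e2 s3).
apply: reach_bind (reach_arith (op := Mul) (u := fun _ _ _ _ => ('C(n, i) * (n - i))%:R) vp2 s3 s1 _) _.
  by move=> R T X h; rewrite /= natrM.
move=> p3 e3 t3; have [vp3 _] := e3.
have {s1 s3 t2}[s1 t2] := (stores_extends e3 s1, stores_extends e3 t2).
apply: reach_bind (reach_arith (op := Div) (u := fun _ _ _ _ => 'C(n, i.+1)%:R) vp3 t3 t2 _) _.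
  move=> R T X h; rewrite /= pnatr_eq0 /= mulnC -mul_bin_left mulnC natrM mulfK //.
  by rewrite pnatr_eq0.
move=> p4 e4 t4; have [vp4 _] := e4.
have [s1' t2'] := (stores_extends e4 s1, stores_extends e4 t2).
have [|p5 e5 t5] := reach_arith (op := Defs.Sub) (u := fun _ _ _ _ => (n - i.+1)%:R) vp4 s1' (stores1 _).
  by move=> R T X h; rewrite /= subnS -subn1 [in RHS]natrB ?subn_gt0.
exists p5 => //.
by split; [exact: t5|exact: stores_extends e5 t2'|exact: stores_extends e5 t4].
Qed.

End Algorithm.

(* In the recursion, m : 'I_n is the 0-based index of the new data point, so  *)
(* that m.+1 and m are the m and m - 1 of the 1-based formula; likewise       *)
(* head m i is i_1 - 1, and rcons i m is (i_1, ..., i_{r-1}, m).  As i and    *)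
(* rcons i m have r - 1 > 0 and r entries, the default values of head and nth *)
(* are not used.                                                              *)
Theorem mainTheorem11 (r : nat) (hr : (2 <= r)%N) :
  (forall (R : realType) (T : Type) (L : finType) (q n : nat)
     (h : L -> r.-tuple T -> R) (X : n.-tuple T),
     (1 <= q)%N -> (q * r <= n)%N ->
     forall (l : L) (c : nat) (m : 'I_n),
       (1 <= c <= q)%N -> (c * r <= m.+1)%N ->
       DM X (h l) c m.+1 =
       DM X (h l) c m +
       \sum_(i : (r.-1).-tuple 'I_n |
               increasing (rcons i m) && (c.-1 * r <= head m i)%N)
         DM X (h l) c.-1 (head m i) *
         h l [tuple tnth X (nth m (rcons i m) j) | j < r])
  /\
  (exists C : nat,
     forall (L : finType) (l : L) (q n : nat),
       (1 <= q)%N -> (q * r <= n)%N ->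
       exists p : program L r n,
         (operations p <= C * (q * n ^ r))%N /\
         forall (R : realType) (T : Type) (h : L -> r.-tuple T -> R)
           (X : n.-tuple T),
           result X h p = Some (DM X (h l) q n))
  /\
  (exists C : nat,
     forall (L : finType) (q n : nat),
       (1 <= q)%N -> (q * r <= n)%N ->
       exists p : program L r n,
         (operations p <= C * (q * n ^ r * #|L|))%N /\
         forall (R : realType) (T : Type) (h : L -> r.-tuple T -> R)
           (X : n.-tuple T),
           result X h p = Some (UM X h q)).

Proof.
(* From here on the block length is [r.+1], with [r] positive. *)
case: r hr => [|[|r']] // _; set r := r'.+1.
have cost (q n : nat) : (1 <= q)%N -> (q * r.+1 <= n)%N ->
    (q * (n * (n ^ r * 3 + 1)) <= 4 * (q * n ^ r.+1))%N /\
    (n <= q * n ^ r.+1)%N /\ (q <= n)%N.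
  move=> q_gt0 le_n; have le_qn : (q <= n)%N.
    by apply: leq_trans le_n; rewrite leq_pmulr.
  have n_gt0 := leq_trans q_gt0 le_qn.
  have nr_gt0 : (0 < n ^ r)%N by rewrite expn_gt0 n_gt0.
  split; last by split; rewrite // expnS mulnCA leq_pmulr // muln_gt0 q_gt0.
  rewrite [X in (_ <= X)%N]mulnCA leq_mul2l expnS mulnCA leq_mul2l.
  by rewrite (mulnC 4%N) -[4%N]/(3 + 1)%N mulnDr muln1 leq_add2l nr_gt0 !orbT.
split; [|split].
- move=> R T L q n h X _ _ l [//|c] m _ _; rewrite (DM_rec X (h l) c m); congr (_ + _).
  rewrite [LHS](bigID (fun i : r.-tuple 'I_n => (c * r.+1 <= head m i)%N)) /=.
  rewrite [X in _ + X]big1 ?addr0 // => i /andP[_]; rewrite -ltnNge => lt.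
  by rewrite DM_small ?mul0r.
(* The 4 comes from [n ^ r * 3 + 1 <= 4 * n ^ r]. *)
- exists 4 => L l q n q_gt0 le_n.
  have vnil : valid ([::] : seq (instr L r.+1 n)) by move=> R T X h; exists [::].
  have [p [vp [s def_p les]] [a pa]] := reach_DM l q vnil.
  have [le _] := cost _ _ q_gt0 le_n.
  exists (Program p a); split=> [|R T h X]; first by rewrite /operations /= def_p; apply: leq_trans les le.
  by have [mem E] := vp R T X h; rewrite /result /= E /= (pa _ _ _ _ _ E).
(* With [Q = q * n ^ r.+1], each [l] costs at most [4 * Q] for the table,
   [n + 4 * (q * r.+1) <= 5 * Q] for the binomial coefficient, and one division and one addition, at
   most [2 * Q]. *)
exists 11 => L q n q_gt0 le_n.
have [le1 [le2 le3]] := cost _ _ q_gt0 le_n.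
have vnil : valid ([::] : seq (instr L r.+1 n)) by move=> R T X h; exists [::].
pose F (l : L) : value L r.+1 n := fun R T X h =>
  DM X (h l) q n / 'C(n, q * r.+1)%:R.
have [|p [vp [s def_p les]] [a pa]] := @reach_sum L r.+1 n L (index_enum L) F _
  (4 * (q * n ^ r.+1) + (n + q * r.+1 * 4 + 1)) vnil.
  move=> l p k [vp _].
  apply: reach_bind (reach_le le1 (reach_DM l q vp)) _ => p1 [vp1 _] s1.
  apply: reach_bind (reach_bin le_n vp1) _ => p2 e2 s2; have [vp2 _] := e2.
  apply: (@reach_arith _ _ _ Div) vp2 (stores_extends e2 s1) s2 _ => R T X h /=.
  by rewrite pnatr_eq0 -leqn0 leqNgt bin_gt0 le_n.
exists (Program p a); split=> [|R T h X].
  rewrite /operations /= def_p; apply: leq_trans les _.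
  have -> : size (index_enum L) = #|L| by rewrite -sum1_size sum1_card.
  rewrite mulnC [X in (_ <= X)%N]mulnA leq_mul2r; apply/orP; right.
  have gt0 : (0 < q * n ^ r.+1)%N := leq_trans (leq_trans q_gt0 le3) le2.
  by move: (q * r.+1)%N (q * n ^ r.+1)%N le_n le2 gt0 => *; lia.
have [mem E] := vp R T X h; rewrite /result /= E /= (pa _ _ _ _ _ E).
congr Some; apply: eq_bigr => l _; rewrite /F mulrC; congr (_ * _).
(* At [m = n] the bound on the entries holds for every tuple over ['I_n], so [DM] is the inner sum
   of [UM]. *)
apply: eq_bigl => i; apply: andb_idr => _.
by apply/allP => j _; apply: ltn_ord.
Qed.
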